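(* Let $\mathcal{M}$ be a matroid of rank $3$. Then all roots of $\mathrm{Rel}(\mathcal{M};q)$ lie in the closed unit disk $\{z\in\mathbb{C}:|z|\le 1\}$.
   Context: A matroid on a nonempty finite set $X$ is a nonempty collection $\mathcal{M}$ of subsets of $X$ closed under taking subsets and satisfying the exchange axiom: if $\sigma,\alpha\in\mathcal{M}$ with $|\sigma|<|\alpha|$, there is $z\in\alpha\setminus\sigma$ with $\sigma\cup\{z\}\in\mathcal{M}$. Its rank is the largest cardinality of a member of $\mathcal{M}$. The reliability polynomial is $\mathrm{Rel}(\mathcal{M};q)=\sum_{\sigma\in\mathcal{M}} q^{|\sigma|}(1-q)^{|X\setminus\sigma|}$. *)

(* Defs.v *)
From HB Require Import structures.
From mathcomp Require Import all_boot all_order all_algebra.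

Set Implicit Arguments.
Unset Strict Implicit.
Unset Printing Implicit Defensive.

Import GRing.Theory.
Local Open Scope ring_scope.

Record matroid (X : finType) := Matroid {
  indep :> {set {set X}};
  matroid_ground_nonempty : (0 < #|X|)%N;
  matroid_nonempty : indep != set0;
  matroid_subset_closed : forall s t : {set X},
    t \in indep -> s \subset t -> s \in indep;
  matroid_exchange : forall s a : {set X},
    s \in indep -> a \in indep -> (#|s| < #|a|)%N ->
    exists2 z, z \in a :\: s & z |: s \in indep
}.

Definition matroid_rank (X : finType) (M : matroid X) : nat :=
  (\max_(s in indep M) #|s|)%N.

Definition Rel (A : comNzRingType) (X : finType) (M : matroid X) : {poly A} :=
  \sum_(s in indep M) 'X ^+ #|s| * (1 - 'X) ^+ #|~: s|.

(* Main.v *)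
Require Import Defs.
From mathcomp Require Import all_boot all_order all_algebra.
From mathcomp Require Import reals complex.
From mathcomp Require Import zify ring lra.

(** With [n = #|X|] and [F k] the number of independent [k]-sets,
    [Rel M = (1 - q)^(n - 3) H(q)] for a cubic [H = 1 + h1 q + h2 q^2 + h3 q^3].

    If [M] has a four-element circuit [C], adding the other elements to [C]
    one at a time never decreases [F3 - 2 F2 + 4 F1 - 8] nor [F3 - F2 + 2],
    which both vanish on [C]: the link of each new element is a rank two matroid
    in which every nonloop has at least two neighbours in [C].  This gives
    [h1 <= h3] and [h2 <= h1 + h3 - 1], which force the roots of [H] into the disk.

    If there is no such circuit, the nonloops split into a parallel class of
    size [p] and a rank two flat, so [H] is [1 + (p - 1) q] times the polynomial
    of a rank two matroid; the latter either has a triangle, and one counts again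
    relative to it, or splits once more into linear factors. *)

Set Implicit Arguments.
Unset Strict Implicit.
Unset Printing Implicit Defensive.

Import Order.TTheory GRing.Theory Num.Theory.
Local Open Scope ring_scope.
Local Open Scope complex_scope.

(** * Location of the complex roots of real polynomials of degree at most three *)

Lemma norm_complex_le1 (R : rcfType) (x y : R) :
  (`|x +i* y| <= 1) = (x ^+ 2 + y ^+ 2 <= 1).
Proof.
rewrite normc_def lecE /= eqxx /= -[X in _ <= X]sqrtr1 ler_sqrt //.
Qed.

Lemma linear_root_norm_le1 (R : rcfType) (p : nat) (z : R[i]) :
  (0 < p)%N -> 1 - z + p%:R * z = 0 -> `|z| <= 1.
Proof.
case: p => // -[|p] _ e.
  by move/eqP: e; rewrite mul1r subrK oner_eq0.
have {}e : p.+1%:R * z = -1.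
  by apply/eqP; rewrite -subr_eq0 opprK -e -[p.+2]addn1 natrD; apply/eqP; ring.
have := congr1 Num.norm e; rewrite normrM normrN1 normr_nat => <-.
by rewrite ler_peMl // ler1n.
Qed.

(** Nonreal roots are conjugate with product [1 / c]. Real roots are negative, and the polynomial is
    positive below [-1]. *)
Lemma quadratic_root_norm_le1 (R : rcfType) (b c : R) (z : R[i]) :
  0 <= b -> 1 <= c -> b <= c + 1 ->
  1 + b%:C * z + c%:C * z ^+ 2 = 0 -> `|z| <= 1.
Proof.
case: z => x y b0 c1 bc /eqP.
rewrite eq_complex /= => /andP[/eqP re /eqP im].
have {}re : 1 + b * x + c * (x ^+ 2 - y ^+ 2) = 0 by rewrite -[RHS]re; ring.
have {}im : y * (b + 2 * c * x) = 0 by rewrite -[RHS]im; ring.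
rewrite norm_complex_le1; move/eqP: im; rewrite mulf_eq0 => /orP[/eqP y0|/eqP im].
  rewrite y0 expr0n addr0; rewrite y0 expr0n subr0 in re.
  have x0 : x <= 0 by rewrite leNgt; apply/negP => x0; nra.
  have x1 : -1 <= x.
    rewrite leNgt; apply/negP => x1.
    (* The polynomial equals [(1 + x)(1 + c x) - (c + 1 - b) x], which is positive for [x < -1]. *)
    have : 0 < (-1 - x) * (- 1 - c * x) by rewrite mulr_gt0 //; nra.
    have : (c + 1 - b) * x <= 0 by rewrite mulr_ge0_le0 // subr_ge0.
    nra.
  nra.
have : c * (x ^+ 2 + y ^+ 2) = 1.
  have -> : c * (x ^+ 2 + y ^+ 2) =
    1 - (1 + b * x + c * (x ^+ 2 - y ^+ 2)) + x * (b + 2 * c * x) by ring.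
  by rewrite re im mulr0 addr0 subr0.
have := sqr_ge0 x; have := sqr_ge0 y; move: (x ^+ 2) (y ^+ 2) => X Y.
nra.
Qed.

(** The cubic is positive on [x > 0] and negative on [x < -1], which settles real roots. For a
    nonreal root, Vieta's relations with its conjugate and the third, real root turn [|z| > 1] into
    a contradiction of signs. *)
Lemma cubic_root_norm_le1 (R : rcfType) (h1 h2 h3 : R) (z : R[i]) :
  0 <= h1 <= h3 -> 1 <= h2 <= h1 + h3 - 1 -> 0 < h3 ->
  1 + h1%:C * z + h2%:C * z ^+ 2 + h3%:C * z ^+ 3 = 0 -> `|z| <= 1.
Proof.
case: z => x y /andP[h1_ge0 h13] /andP[h2_ge1 h2_le] h3_gt0 /eqP.
rewrite eq_complex /= => /andP[/eqP re /eqP im].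
have {}re : 1 + h1 * x + h2 * (x ^+ 2 - y ^+ 2) +
            h3 * (x ^+ 3 - 3 * x * y ^+ 2) = 0 by rewrite -[RHS]re; ring.
have {}im : y * (h1 + 2 * h2 * x + h3 * (3 * x ^+ 2 - y ^+ 2)) = 0.
  by rewrite -[RHS]im; ring.
rewrite norm_complex_le1; have [y0|yN0] := eqVneq y 0.
  rewrite y0 expr0n addr0; rewrite y0 expr0n mulr0 !subr0 in re.
  have x0 : x <= 0.
    rewrite leNgt; apply/negP => x0.
    have : 0 <= h1 * x by rewrite mulr_ge0 // ltW.
    have : 0 <= h2 * x ^+ 2 by rewrite mulr_ge0 ?sqr_ge0 //; lra.
    have : 0 <= h3 * x ^+ 3 by rewrite mulr_ge0 ?exprn_ge0 ?ltW.
    lra.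
  have x1 : -1 <= x.
    rewrite leNgt; apply/negP => x1.
    have le : h2 * x ^+ 2 <= (h1 + h3 - 1) * x ^+ 2 by rewrite ler_wpM2r ?sqr_ge0.
    (* Replacing [h2] by its upper bound [h1 + h3 - 1] makes the cubic divisible by [1 + x]; the
       quotient is the second factor here. *)
    have : 0 < (-1 - x) * (1 - x + h1 * x * (x + 1) + (h3 - h1) * x ^+ 2).
      rewrite mulr_gt0 ?subr_gt0 // ltr_pwDl //; last first.
        by rewrite mulr_ge0 ?sqr_ge0 ?subr_ge0.
      rewrite ltr_pwDl //; first lra.
      by rewrite -mulrA mulr_ge0 //; nra.
    nra.
  nra.
move/eqP: im; rewrite mulf_eq0 (negbTE yN0) /= => /eqP im.
(* If [r] is the third root, then [w = - h3 r], and [wN] is Vieta's formula for the product of the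
   roots. *)
set w := h2 + 2 * h3 * x.
have wN : w * (x ^+ 2 + y ^+ 2) = 1.
  have -> : w * (x ^+ 2 + y ^+ 2) = 1 -
     (1 + h1 * x + h2 * (x ^+ 2 - y ^+ 2) + h3 * (x ^+ 3 - 3 * x * y ^+ 2)) +
     x * (h1 + 2 * h2 * x + h3 * (3 * x ^+ 2 - y ^+ 2)) by rewrite /w; ring.
  by rewrite re im mulr0 addr0 subr0.
rewrite leNgt; apply/negP => N1.
have w1 : w < 1.
  rewrite ltNge; apply/negP => w1.
  have : 1 < w * (x ^+ 2 + y ^+ 2).
    by rewrite (lt_le_trans N1) // ler_peMl // ltW // (lt_trans _ N1).
  by rewrite wN ltxx.
have h1E : h1 = h3 * (x ^+ 2 + y ^+ 2) - 2 * x * w.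
  by apply/eqP; rewrite -subr_eq0 -[X in _ == X]im /w; apply/eqP; ring.
(* The second factor is [|1 + h3 z|^2], positive because [h3 y] is nonzero. Vieta's formulas rewrite
   the same product as [(h3 - h1) h3 + (h2 - 1)], which is nonnegative. *)
have : (w - 1) * (1 + 2 * x * h3 + h3 ^+ 2 * (x ^+ 2 + y ^+ 2)) < 0.
  rewrite nmulr_rlt0 ?subr_lt0 //.
  have -> : 1 + 2 * x * h3 + h3 ^+ 2 * (x ^+ 2 + y ^+ 2) =
     (1 + x * h3) ^+ 2 + (h3 * y) ^+ 2 by ring.
  by rewrite ltr_wpDl ?sqr_ge0 // lt_def sqr_ge0 expf_neq0 // mulf_neq0 // gt_eqF.
have -> : (w - 1) * (1 + 2 * x * h3 + h3 ^+ 2 * (x ^+ 2 + y ^+ 2)) =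
   (h3 - h1) * h3 + (h2 - 1) + h3 ^+ 2 * (w * (x ^+ 2 + y ^+ 2) - 1).
  by rewrite h1E /w; ring.
rewrite wN subrr mulr0 addr0 ltNge => /negP; apply.
by rewrite addr_ge0 ?subr_ge0 // mulr_ge0 ?subr_ge0 // ltW.
Qed.

(** * Counting independent sets through ordered tuples *)

Section Counting.
Local Open Scope nat_scope.
Variable X : finType.

(** Incidences of a point with a member of size [k + 1] are counted twice; removing the point leaves
    a member of its link. The family [P] is arbitrary so that the identity can be iterated on
    links. *)
Lemma double_count_card (P : {set {set X}}) k :
  k.+1 * #|[set s in P | #|s| == k.+1]| =
  \sum_x #|[set s in [set s : {set X} | (x \notin s) && (x |: s \in P)] | #|s| == k]|.
Proof.
set A := [set s in P | _].
transitivity (\sum_(s in A) #|s|).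
  rewrite mulnC -sum_nat_const; apply: eq_bigr => s.
  by rewrite inE => /andP[_ /eqP].
transitivity (\sum_(s in A) \sum_(x | x \in s) 1).
  by apply: eq_bigr => s _; rewrite sum1_card.
rewrite (exchange_big_dep predT) //=; apply: eq_bigr => x _.
rewrite sum1dep_card -[RHS](card_in_imset (f := fun s => x |: s)); last first.
  move=> s t; rewrite !inE => /andP[/andP[xs _] _] /andP[/andP[xt _] _] e.
  by rewrite -(setU1K xs) e setU1K.
apply: eq_card => s; rewrite !inE; apply/andP/imsetP.
  move=> [/andP[sP /eqP ks] xs]; exists (s :\ x); last by rewrite setD1K.
  rewrite !inE setD1K // sP eqxx /=.
  by move/eqP: ks; rewrite (cardsD1 x) xs add1n eqSS.
case=> t; rewrite !inE => /andP[/andP[xt tP] /eqP kt] ->.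
by rewrite tP setU11 cardsU1 xt kt eqxx.
Qed.

Lemma card_size0 (P : {set {set X}}) : #|[set s in P | #|s| == 0]| = (set0 \in P).
Proof.
case: (boolP (set0 \in P)) => h.
  rewrite -[RHS](cards1 (@set0 X)); apply: eq_card => s; rewrite !inE cards_eq0.
  by case: eqP => [->|]; rewrite ?andbF ?h.
apply/eqP; rewrite cards_eq0; apply/eqP/setP => s; rewrite !inE cards_eq0.
by case: eqP => [->|]; rewrite ?andbF ?(negbTE h).
Qed.

Variable M : matroid X.

Definition indep1 x := [set x] \in indep M.
(** Distinctness is built into the predicates on pairs and triples, so sums over all ordered tuples
    count each independent pair twice and each independent triple six times. *)
Definition indep2 x y := (x != y) && ([set x; y] \in indep M).
Definition indep3 x y z := uniq [:: x; y; z] && ([set x; y; z] \in indep M).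

Definition count_indep k := #|[set s in indep M | #|s| == k]|.

Lemma set0_indep : set0 \in indep M.
Proof.
have /set0Pn[s sM] := matroid_nonempty M.
exact: matroid_subset_closed sM (sub0set s).
Qed.

Lemma count_indep0 : count_indep 0 = 1.
Proof. by rewrite /count_indep card_size0 set0_indep. Qed.

Lemma count_indep1 : count_indep 1 = \sum_x indep1 x.
Proof.
rewrite -[LHS]mul1n /count_indep double_count_card.
by apply: eq_bigr => x _; rewrite card_size0 !inE setU0.
Qed.

Lemma count_indep2 : 2 * count_indep 2 = \sum_x \sum_y indep2 x y.
Proof.
rewrite /count_indep double_count_card; apply: eq_bigr => x _.
rewrite -[LHS]mul1n double_count_card; apply: eq_bigr => y _.
by rewrite card_size0 !inE setU0 orbF.
Qed.

Lemma count_indep3 : 6 * count_indep 3 = \sum_x \sum_y \sum_z indep3 x y z.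
Proof.
rewrite -[6]/(2 * 3) -mulnA /count_indep double_count_card big_distrr /=.
apply: eq_bigr => x _; rewrite double_count_card; apply: eq_bigr => y _.
rewrite -[LHS]mul1n double_count_card; apply: eq_bigr => z _.
rewrite card_size0 !inE setU0 /indep3 /= !inE andbT.
congr (nat_of_bool _); rewrite setUA; move: (_ \in indep M).
by case: (x == y); case: (x == z); case: (y == z); case.
Qed.

Lemma indep2C x y : indep2 x y = indep2 y x.
Proof. by rewrite /indep2 eq_sym setUC. Qed.

Lemma indep3C x y z : indep3 x y z = indep3 y x z.
Proof.
rewrite /indep3 /= !inE !negb_or (eq_sym y x) [[set y; x]]setUC.
by move: (_ \in indep M); case: (x == y); case: (x == z); case: (y == z); case.
Qed.

Lemma indep3AC x y z : indep3 x y z = indep3 x z y.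
Proof.
rewrite /indep3 /= !inE !negb_or (eq_sym z y) setUAC.
by move: (_ \in indep M); case: (x == y); case: (x == z); case: (y == z); case.
Qed.

Lemma indep2W x y : indep2 x y -> indep1 x.
Proof.
case/andP => _ h; apply: matroid_subset_closed h _.
by rewrite sub1set !inE eqxx.
Qed.

Lemma indep3W x y z : indep3 x y z -> indep2 x y.
Proof.
rewrite /indep3 /= !inE !negb_or => /andP[/andP[/andP[xy _] _] h].
rewrite /indep2 xy; apply: matroid_subset_closed h _.
exact: subsetUl.
Qed.

Lemma indep3_pairs x y z : indep3 x y z -> [/\ indep2 x y, indep2 x z & indep2 y z].
Proof.
move=> h; split; first exact: indep3W h.
  by apply: (@indep3W _ _ y); rewrite indep3AC.
by apply: (@indep3W _ _ x); rewrite indep3AC indep3C.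
Qed.

Lemma indep3_rot x y z : indep3 x y z = indep3 y z x.
Proof. by rewrite indep3C [RHS]indep3AC. Qed.

Lemma indep2xx x : indep2 x x = false.
Proof. by rewrite /indep2 eqxx. Qed.

Lemma indep3xx x y : indep3 x x y = false.
Proof. by rewrite /indep3 /= !inE eqxx. Qed.

Lemma indep3xyy x y : indep3 x y y = false.
Proof. by rewrite indep3_rot indep3xx. Qed.

Lemma indep2_exchange x y z : indep1 x -> indep2 y z -> indep2 x y || indep2 x z.
Proof.
move=> hx /andP[yz hyz].
have [|w] := matroid_exchange hx hyz; first by rewrite cards1 cards2 yz.
rewrite !inE => /andP[wx /orP[]/eqP e h]; subst w; apply/orP; [left|right];
  by rewrite /indep2 eq_sym wx setUC.
Qed.

Lemma indep3_exchange x y u v w : indep2 x y -> indep3 u v w ->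
  [|| indep3 x y u, indep3 x y v | indep3 x y w].
Proof.
move=> /andP[xy hxy] /andP[]; rewrite /= !inE negb_or.
move=> /andP[/andP[uv uw] /andP[vw _]] huvw.
have [|t] := matroid_exchange hxy huvw.
  by rewrite cards2 xy setUC cardsU1 cards2 uv !inE negb_or ![w == _]eq_sym uw vw.
rewrite !inE negb_or => /andP[/andP[tx ty] tuvw] h.
suff : indep3 x y t by case/orP: tuvw => [/orP[]|] /eqP-> ->; rewrite ?orbT.
by rewrite /indep3 /= !inE !negb_or xy ![_ == t]eq_sym tx ty setUC.
Qed.

End Counting.

(** * Sums over the ground set, split along a chosen list of points *)

Section Structure.
Local Open Scope nat_scope.

(** Of the four blocks of the double sum, the one inside [t] is discarded and the two mixed ones
    agree by symmetry. *)
Lemma sum_pairs_ge (X : eqType) (K : X -> X -> nat) (t C : seq X) :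
  (forall x y, K x y = K y x) ->
  2 * (\sum_(y <- t) \sum_(z <- C) K y z) + \sum_(y <- C) \sum_(z <- C) K y z
  <= \sum_(y <- t ++ C) \sum_(z <- t ++ C) K y z.
Proof.
move=> Ksym; rewrite big_cat /=.
under [X in _ <= X + _]eq_bigr do rewrite big_cat /=.
under [X in _ <= _ + X]eq_bigr do rewrite big_cat /=.
rewrite !big_split /= [X in _ <= _ + (X + _)]exchange_big /=.
under [X in _ <= _ + (X + _)]eq_bigr => y _ do
  under eq_bigr => z _ do rewrite Ksym.
lia.
Qed.

Lemma sum_extend (X : finType) (C : seq X) (F : X -> nat) : uniq C ->
  \sum_x F x = \sum_(x <- [seq x <- index_enum X | x \notin C] ++ C) F x.
Proof.
move=> uC; apply: perm_big; apply: uniq_perm.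
- exact: index_enum_uniq.
- rewrite cat_uniq uC filter_uniq ?index_enum_uniq //= andbT.
  by apply/hasPn => x xC; rewrite mem_filter xC.
- by move=> x; rewrite mem_cat mem_filter mem_index_enum andbT orNb.
Qed.

Variables (X : finType) (M : matroid X).

Local Notation v := (indep1 M).
Local Notation J := (indep2 M).
Local Notation I := (indep3 M).

(** In rank three this describes a four-element circuit: the four points together are dependent for
    reasons of size. *)
Definition four_circuit a b c d :=
  [&& I a b c, I a b d, I a c d & I b c d].

(** * Count inequalities in the presence of a four-element circuit *)

Section FourCircuit.
Variables a b c d : X.
Hypothesis abcd : four_circuit a b c d.
Let C := [:: a; b; c; d].

(** If at most one point of [C] extended the pair, the other three would form an independent triple
    violating exchange. *)
Lemma four_circuit_degree r y : 2 * J r y <= \sum_(z <- C) I r y z.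
Proof.
have [ry|//] := boolP (J r y).
case/and4P: abcd => h1 h2 h3 h4.
have := indep3_exchange ry h1; have := indep3_exchange ry h2.
have := indep3_exchange ry h3; have := indep3_exchange ry h4.
rewrite !big_cons big_nil.
by case: (I r y a); case: (I r y b); case: (I r y c); case: (I r y d).
Qed.

Lemma four_circuit_indep2 :
  [/\ [&& J a b, J a c & J a d], [&& J b a, J b c & J b d],
      [&& J c a, J c b & J c d] & [&& J d a, J d b & J d c]].
Proof.
case/and4P: abcd => h1 h2 h3 h4.
have [ab ac bc] := indep3_pairs h1; have [_ ad bd] := indep3_pairs h2.
have [_ _ cd] := indep3_pairs h3.
by rewrite ab ac ad bc bd cd (indep2C M b a) (indep2C M c) (indep2C M c b)
  !(indep2C M d) ab ac ad bc bd cd.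
Qed.

(** Two points of [C] parallel to [y] would form an independent pair violating exchange, so at most
    one fails. *)
Lemma four_circuit_degree2 y : 3 * v y <= \sum_(z <- C) J y z.
Proof.
have [vy|//] := boolP (v y).
case: four_circuit_indep2 => /and3P[ab ac ad] /and3P[_ bc bd] /and3P[_ _ cd] _.
have := indep2_exchange vy ab; have := indep2_exchange vy ac.
have := indep2_exchange vy ad; have := indep2_exchange vy bc.
have := indep2_exchange vy bd; have := indep2_exchange vy cd.
rewrite !big_cons big_nil.
by case: (J y a); case: (J y b); case: (J y c); case: (J y d).
Qed.

Lemma four_circuit_uniq : uniq C.
Proof.
have neq x y : J x y -> x != y by case/andP.
case: four_circuit_indep2 => /and3P[ab ac ad] /and3P[_ bc bd] /and3P[_ _ cd] _.
by rewrite /= !inE !negb_or !neq.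
Qed.

Lemma four_circuit_sum1 : \sum_(x <- C) v x = 4.
Proof.
case: four_circuit_indep2 => /and3P[ab _ _] /and3P[ba _ _] /and3P[ca _ _] /and3P[da _ _].
by rewrite !big_cons big_nil (indep2W ab) (indep2W ba) (indep2W ca) (indep2W da).
Qed.

Lemma four_circuit_sum2 : \sum_(x <- C) \sum_(y <- C) J x y = 12.
Proof.
case: four_circuit_indep2 => h1 h2 h3 h4.
rewrite !big_cons !big_nil !indep2xx.
by move: h1 h2 h3 h4; do 4!case/and3P => -> -> ->.
Qed.

Lemma four_circuit_sum3 : 24 <= \sum_(x <- C) \sum_(y <- C) \sum_(z <- C) I x y z.
Proof.
rewrite -[24]/(2 * 12) -four_circuit_sum2 big_distrr leq_sum // => x _.
by rewrite big_distrr leq_sum // => y _; exact: four_circuit_degree.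
Qed.

(** Write [k = k_t + k_C] for the neighbours of [r] in [t] and in [C]. Each has at least two link
    neighbours in [C], and the mixed block counts twice, so [e >= 4 k_t + 2 k_C]; moreover [k_C] is
    at most 4, and 0 if [r] is a loop. *)
Lemma four_circuit_link t r (T := t ++ C) :
  let k := \sum_(y <- T) J r y in
  let e := \sum_(y <- T) \sum_(z <- T) I r y z in
  4 * k <= e + 8 * v r /\ 2 * k <= e.
Proof.
move=> k e.
have e_ge : 2 * (\sum_(y <- t) \sum_(z <- C) I r y z) +
    \sum_(y <- C) \sum_(z <- C) I r y z <= e.
  by apply: (sum_pairs_ge (K := fun y z => I r y z)) => y z; rewrite indep3AC.
have deg s : 2 * (\sum_(y <- s) J r y) <= \sum_(y <- s) \sum_(z <- C) I r y z.
  by rewrite big_distrr leq_sum // => y _; exact: four_circuit_degree.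
have kE : k = \sum_(y <- t) J r y + \sum_(y <- C) J r y by rewrite /k big_cat.
have kC : \sum_(y <- C) J r y <= 4 * v r.
  have J1 y : J r y <= v r by case: (boolP (J r y)) => // /indep2W ->.
  have := J1 a; have := J1 b; have := J1 c; have := J1 d.
  rewrite !big_cons big_nil.
  by case: (v r); case: (J r a); case: (J r b); case: (J r c); case: (J r d).
have := deg t; have := deg C; clearbody k e.
move: kE kC e_ge.
move: (\sum_(y <- t) _) (\sum_(y <- C) _) (\sum_(y <- t) _) (\sum_(y <- C) _).
move=> n1 n2 n3 n4.
move: (nat_of_bool _) => n5.
lia.
Qed.

Lemma sum_indep2_cons r T :
  \sum_(x <- r :: T) \sum_(y <- r :: T) J x y =
  \sum_(x <- T) \sum_(y <- T) J x y + 2 * \sum_(y <- T) J r y.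
Proof.
under eq_bigr do rewrite big_cons.
rewrite big_split /= !big_cons indep2xx.
under eq_bigr do rewrite indep2C.
lia.
Qed.

Lemma sum_indep3_cons r T :
  \sum_(x <- r :: T) \sum_(y <- r :: T) \sum_(z <- r :: T) I x y z =
  \sum_(x <- T) \sum_(y <- T) \sum_(z <- T) I x y z +
  3 * \sum_(y <- T) \sum_(z <- T) I r y z.
Proof.
have E1 x : \sum_(y <- r :: T) \sum_(z <- r :: T) I x y z =
    \sum_(y <- T) \sum_(z <- T) I x y z + 2 * (\sum_(y <- T) I r x y) .
  rewrite big_cons [X in X + _]big_cons indep3xyy.
  under [X in _ + X]eq_bigr => y _ do rewrite big_cons.
  rewrite big_split /=.
  under eq_bigr => y _ do rewrite indep3C.
  under [X in _ + (X + _)]eq_bigr => y _ do rewrite -indep3_rot.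
  lia.
rewrite big_cons E1; under [X in _ + X]eq_bigr do rewrite E1.
rewrite big_split /= -big_distrr /=.
rewrite [\sum_(y <- T) I r r y]big1 => [|y _]; last by rewrite indep3xx.
lia.
Qed.

(** By induction on [t]: on [C] alone the counts 4, 12 and at least 24 suffice, and adding [r]
    increases [f1], [f2], [f3] by [v r], [2 k], [3 e] in the notation of [four_circuit_link], whose
    bounds are exactly those required. *)
Lemma four_circuit_counts_seq t (T := t ++ C)
    (f1 := \sum_(x <- T) v x) (f2 := \sum_(x <- T) \sum_(y <- T) J x y)
    (f3 := \sum_(x <- T) \sum_(y <- T) \sum_(z <- T) I x y z) :
  6 * f2 + 48 <= f3 + 24 * f1 /\ 3 * f2 <= f3 + 12.
Proof.
rewrite {}/f1 {}/f2 {}/f3 {}/T; elim: t => [|r t IHt].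
  rewrite cat0s four_circuit_sum1 four_circuit_sum2; have := four_circuit_sum3; lia.
rewrite cat_cons sum_indep2_cons sum_indep3_cons big_cons.
have [] := four_circuit_link t r; case: IHt.
move: (\sum_(x <- t ++ C) v x) (\sum_(x <- t ++ C) \sum_(y <- t ++ C) J x y).
move: (\sum_(x <- t ++ C) \sum_(y <- t ++ C) \sum_(z <- t ++ C) I x y z).
move: (\sum_(y <- t ++ C) J r y) (nat_of_bool (v r)).
move: (\sum_(y <- t ++ C) \sum_(z <- t ++ C) I r y z).
lia.
Qed.

(** In terms of the coefficients of [H], the first two bounds are [h2 <= h1 + h3 - 1] and
    [h1 <= h3]; the last two give [h2 >= 1] and [h1 >= 1]. *)
Lemma four_circuit_counts (F := count_indep M) :
  [/\ 2 * F 2 + 8 <= F 3 + 4 * F 1, F 2 <= F 3 + 2,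
      3 * F 1 <= F 2 + 6 & 4 <= F 1].
Proof.
set t := [seq x <- index_enum X | x \notin C].
have E1 : F 1 = \sum_(x <- t ++ C) v x.
  by rewrite /F count_indep1 (sum_extend _ four_circuit_uniq).
have E2 : 2 * F 2 = \sum_(x <- t ++ C) \sum_(y <- t ++ C) J x y.
  rewrite /F count_indep2 (sum_extend _ four_circuit_uniq).
  by apply: eq_bigr => x _; rewrite (sum_extend _ four_circuit_uniq).
have E3 : 6 * F 3 = \sum_(x <- t ++ C) \sum_(y <- t ++ C) \sum_(z <- t ++ C) I x y z.
  rewrite /F count_indep3 (sum_extend _ four_circuit_uniq).
  apply: eq_bigr => x _; rewrite (sum_extend _ four_circuit_uniq).
  by apply: eq_bigr => y _; rewrite (sum_extend _ four_circuit_uniq).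
have [le1 le2] := four_circuit_counts_seq t.
have JC x y : (J x y : nat) = J y x by rewrite indep2C.
(* With the degree bound this yields [2 F2 >= 6 (F1 - 4) + 12], the third inequality. *)
have := sum_pairs_ge t C JC.
have deg s : 3 * (\sum_(y <- s) v y) <= \sum_(y <- s) \sum_(z <- C) J y z.
  by rewrite big_distrr leq_sum // => y _; exact: four_circuit_degree2.
have := deg t; rewrite four_circuit_sum2.
move: E1; rewrite big_cat /= four_circuit_sum1 => E1.
move: le1 le2; rewrite -E2 -E3 big_cat /= four_circuit_sum1 -E1; split; lia.
Qed.

End FourCircuit.

(* Two points strictly inside two different sides of a triangle form a
   four-circuit with the two vertices that the sides do not share. *)
Lemma two_sides_four_circuit p q r x z :
  I p q r -> J x p -> J x q -> ~~ I x p q -> J z p -> J z r -> ~~ I z p r ->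
  four_circuit x z q r.
Proof.
move=> pqr xp xq /negbTE xpq zp zr /negbTE zpr.
have xqr : I x q r.
  by have := indep3_exchange xq pqr; rewrite indep3AC xpq indep3xyy.
have zqr : I z q r.
  by have := indep3_exchange zr pqr; rewrite indep3AC zpr indep3xyy orbF /= indep3AC.
have zpq : I z p q.
  by have := indep3_exchange zp pqr; rewrite zpr indep3xyy orbF.
have xpr : I x p r.
  by have := indep3_exchange xp pqr; rewrite xpq indep3xyy.
have xzq : I x z q.
  have := indep3_exchange xq zpq.
  by rewrite indep3AC [I x q p]indep3AC xpq indep3xyy !orbF.
have xzr : I x z r.
  have := indep3_exchange zr xpr; rewrite [I z r p]indep3AC zpr indep3xyy !orbF.
  by rewrite indep3AC indep3C.
by rewrite /four_circuit xqr zqr xzq xzr.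
Qed.

(** * The dichotomy between four-element circuits and split bases *)

(** Every nonloop is either parallel to [c] or in the span of [a] and [b]. *)
Definition split_basis a b c :=
  I a b c /\ forall x, v x -> J x c -> ~~ I x a b.

(** If both alternatives fail, each side of the basis triangle is avoided by some point strictly
    inside another side. These three points cannot all lie on one side, and two on different sides
    produce a four-circuit. *)
Lemma four_circuit_or_split a0 b0 c0 : I a0 b0 c0 ->
  (exists a b c d, four_circuit a b c d) \/ (exists a b c, split_basis a b c).
Proof.
move=> abc.
have [/existsP[a /existsP[b /existsP[c /existsP[d h]]]]|nofour] :=
    boolP [exists a, exists b, exists c, exists d, four_circuit a b c d].
  by left; exists a, b, c, d.
have {}nofour a b c d : ~~ four_circuit a b c d.
  apply: contra nofour => h.
  by apply/existsP; exists a; apply/existsP; exists b; apply/existsP; exists c;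
     apply/existsP; exists d.
right.
have bca : I b0 c0 a0 by rewrite -indep3_rot.
have cab : I c0 a0 b0 by rewrite indep3_rot.
have acb : I a0 c0 b0 by rewrite indep3AC.
have cba : I c0 b0 a0 by rewrite indep3_rot indep3C.
(* A point off one side and not parallel to the opposite vertex lies strictly
   inside another side. *)
have off a b c : I a b c -> split_basis a b c \/
    exists x, [&& J x a, J x b & J x c] /\ (~~ I x a c \/ ~~ I x b c).
  move=> h; have [/existsP[x /and3P[vx xc xab]]|no] :=
      boolP [exists x, [&& v x, J x c & I x a b]]; last first.
    left; split=> // x vx xc; apply: contra no => xab.
    by apply/existsP; exists x; rewrite vx xc.
  right; exists x; split.
    rewrite xc (indep3W xab); rewrite indep3AC in xab; by rewrite (indep3W xab).
  have := nofour x a b c; rewrite /four_circuit xab h andbT /=.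
  by rewrite negb_and => /orP.
have clash p q r x z : I p q r -> [&& J x p, J x q & J x r] ->
    [&& J z p, J z q & J z r] -> ~~ I x p q -> ~~ I z p r -> False.
  move=> h /and3P[xp xq _] /and3P[zp _ zr] xpq zpr.
  by have /negP := nofour x z q r; apply; exact: two_sides_four_circuit zpr.
have [|[x [/and3P[xa xb xc] xs]]] := off _ _ _ abc; first by exists a0, b0, c0.
have [|[y [/and3P[yb yc ya] ys]]] := off _ _ _ bca; first by exists b0, c0, a0.
have [|[z [/and3P[za zc zb] zs]]] := off _ _ _ acb; first by exists a0, c0, b0.
(* The point [z] avoids the side [a0 c0] and [y] avoids [b0 c0], so whichever of these contains [x],
   one of [y] and [z] lies on another side. *)
exfalso; case: xs => xs.
  case: zs => zs; first by apply: (clash a0 c0 b0 x z); rewrite ?xa ?xb ?xc ?za ?zb ?zc.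
  apply: (clash c0 a0 b0 x z) => //; rewrite ?xa ?xb ?xc ?za ?zb ?zc //.
  by rewrite indep3AC.
case: ys => ys.
  apply: (clash b0 c0 a0 x y) => //; by rewrite ?xa ?xb ?xc ?ya ?yb ?yc.
apply: (clash c0 b0 a0 x y) => //; rewrite ?xa ?xb ?xc ?ya ?yb ?yc //.
by rewrite indep3AC.
Qed.

(** * Counts for a parallel class together with a rank two flat *)

Section Split.
Variables a b c : X.
Hypothesis abc : split_basis a b c.

(** [P] is the parallel class of [c] and [L] the set of nonloops of the flat spanned by [a] and [b];
    [e2] is twice the number of independent pairs in [L]. *)
Let P x := v x && ~~ J x c.
Let L x := v x && J x c.
Let LL x y := [&& L x, L y & J x y].
Let p := \sum_x P x.
Let l := \sum_x L x.
Let e2 := \sum_x \sum_y LL x y.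

Let ab : J a b. Proof. by case: abc => /indep3W. Qed.
Let ac : J a c. Proof. by case: abc => /indep3_pairs[]. Qed.
Let bc : J b c. Proof. by case: abc => /indep3_pairs[]. Qed.
Let La : L a. Proof. by rewrite /L (indep2W ab). Qed.
Let Lb : L b. Proof. by rewrite /L (indep2W bc). Qed.
Let vc : v c. Proof. by move: bc; rewrite indep2C => /indep2W. Qed.

Let PP x y : P x -> P y -> J x y = false.
Proof.
move=> /andP[vx xc] /andP[vy yc]; apply/negP => xy.
by have := indep2_exchange vc xy; rewrite ![J c _]indep2C (negbTE xc) (negbTE yc).
Qed.

Let PL x y : P x -> L y -> J x y.
Proof.
move=> /andP[vx xc] /andP[vy yc].
by have := indep2_exchange vx yc; rewrite (negbTE xc) orbF.
Qed.

Let LLL x y z : L x -> L y -> L z -> I x y z = false.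
Proof.
case: abc => _ h /andP[vx xc] /andP[vy yc] /andP[vz zc]; apply/negP => xyz.
have := indep3_exchange ab xyz.
have F w : v w -> J w c -> I a b w = false.
  by move=> vw wc; apply/negbTE; rewrite indep3AC indep3C; exact: h.
by rewrite !F.
Qed.

(** Being parallel to [c], the point [x] completes [a], [b] to a basis. Exchange from this basis
    into the pair [y], [z] can only add [x], since [a] and [b] lie in the same flat as the pair. *)
Let PLL x y z : P x -> L y -> L z -> J y z -> I x y z.
Proof.
move=> Px Ly Lz yz.
have xab : I x a b.
  have [habc _] := abc.
  have := indep3_exchange (PL Px La) habc.
  rewrite indep3xyy.
  rewrite /= => /orP[//|xac]; exfalso; case/andP: Px => _ /negP; apply.
  by case: (indep3_pairs xac).
have := indep3_exchange yz xab; rewrite [I y z a]LLL // [I y z b]LLL // !orbF.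
by rewrite indep3AC indep3C.
Qed.

Let vE x : v x = P x || L x :> bool.
Proof. by rewrite /P /L; case: (v x); case: (J x c). Qed.

Let disj x : P x -> L x = false.
Proof. by rewrite /P /L => /andP[->/negbTE->]. Qed.

Lemma split_count1 : count_indep M 1 = p + l.
Proof.
rewrite count_indep1 /p /l -big_split; apply: eq_bigr => x _ /=.
by rewrite vE; case: (boolP (P x)) => // /disj ->.
Qed.

Let JE x y : (J x y = P x * L y + L x * P y + LL x y :> nat).
Proof.
rewrite /LL; have [/negP N|] := boolP (~~ (v x && v y)).
  have -> : J x y = false.
    apply/negP => h; apply: N; rewrite (indep2W h).
    by rewrite indep2C in h; exact: indep2W h.
  move: N; rewrite /P /L.
  by case: (v x); case: (v y) => //= N; rewrite ?andbF ?muln0 //; exfalso; exact: N.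
rewrite negbK => /andP[vx vy].
move: vx vy; rewrite !vE => /orP[] hx /orP[] hy.
- by rewrite PP // hx hy !disj.
- by rewrite PL // hx hy disj //; case: (boolP (P y)) => // /disj; rewrite hy.
- rewrite indep2C PL // hx hy [L y]disj //; by rewrite muln0 andbF.
- rewrite hx hy /=; case: (boolP (P x)) => [/disj|_]; rewrite ?hx //.
  by case: (boolP (P y)) => [/disj|_]; rewrite ?hy.
Qed.

Lemma split_count2 : 2 * count_indep M 2 = 2 * (p * l) + e2.
Proof.
rewrite count_indep2; under eq_bigr do under eq_bigr do rewrite JE.
under eq_bigr do rewrite !big_split /= -!big_distrr /=.
by rewrite !big_split /= -!big_distrl /= -/p -/l -/e2; lia.
Qed.

(** Two points of [P], or three of [L], are dependent, so an independent triple has exactly one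
    entry in [P] and exactly one product is nonzero. *)
Let IE x y z : (I x y z = P x * LL y z + P y * LL x z + P z * LL x y :> nat).
Proof.
have [/negP N|] := boolP (~~ [&& v x, v y & v z]).
  have -> : I x y z = false.
    apply/negP => h; apply: N; have [xy xz yz] := indep3_pairs h.
    rewrite (indep2W xy) (indep2W yz) /=.
    by rewrite indep2C in xz; exact: indep2W xz.
  move: N; rewrite /LL /P /L.
  by case: (v x); case: (v y); case: (v z) => //= N;
    rewrite ?andbF ?muln0 //; exfalso; exact: N.
rewrite negbK => /and3P[]; rewrite !vE.
have I2 u w t : P u -> P w -> I u w t = false.
  by move=> hu hw; apply/negP => /indep3W; rewrite PP.
have LP u : L u -> P u = false by move=> hu; apply/negP => /disj; rewrite hu.
move=> /orP[] hx /orP[] hy /orP[] hz; rewrite /LL.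
- by rewrite I2 // !disj // !andbF !muln0.
- by rewrite I2 // hx hy hz !(disj hx) !(disj hy) (LP z hz).
- by rewrite indep3AC I2 // hx hz !(disj hx) !(disj hz) (LP y hy) !andbF !muln0.
- rewrite hx hy hz (LP y hy) (LP z hz) /= mul1n !mul0n !addn0.
  case: (boolP (J y z)) => yz; first by rewrite PLL.
  case: (boolP (I x y z)) => // h; case/negP: yz.
  by case: (indep3_pairs h).
- by rewrite indep3C indep3AC I2 // !(disj hy) !(disj hz) (LP x hx) !andbF !muln0.
- rewrite hx hy hz (LP x hx) (LP z hz) /= mul1n !mul0n !addn0 add0n.
  case: (boolP (J x z)) => xz; first by rewrite indep3C PLL.
  case: (boolP (I x y z)) => // h; case/negP: xz.
  by case: (indep3_pairs h).
- rewrite hx hy hz (LP x hx) (LP y hy) /= mul1n !mul0n !add0n.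
  case: (boolP (J x y)) => xy; first by rewrite -indep3_rot PLL.
  by case: (boolP (I x y z)) => // h; case/negP: xy; exact: indep3W h.
- by rewrite LLL // !LP.
Qed.

Lemma split_count3 : 2 * count_indep M 3 = p * e2.
Proof.
suff : 6 * count_indep M 3 = 3 * (p * e2) by lia.
rewrite count_indep3; under eq_bigr do under eq_bigr do under eq_bigr do rewrite IE.
under eq_bigr do under eq_bigr do rewrite !big_split /= -!big_distrr /= -big_distrl /=.
under eq_bigr do rewrite !big_split /= -!big_distrr /= -big_distrl /=.
rewrite !big_split /= -big_distrl /= -big_distrr /= -/p -/e2.
lia.
Qed.

Lemma split_pos : 0 < p.
Proof. by rewrite /p (bigD1 c) //= /P vc indep2xx. Qed.

(** If some [t] in [L] is parallel to neither [a] nor [b], every point of [L] has at least two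
    neighbours in this triangle, so [e2 >= 4 (l - 3) + 6]. Otherwise [L] consists of the parallel
    classes of [a] and [b]. *)
Lemma split_rank2 : (3 <= l /\ 4 * l <= e2 + 6) \/
  exists u w, [/\ 0 < u, 0 < w, l = u + w & e2 = 2 * (u * w)].
Proof.
have [/existsP[t /and3P[Lt ta tb]]|no] := boolP [exists t, [&& L t, J t a & J t b]].
  left; pose B := [:: a; b; t].
  have uB : uniq B.
    rewrite /= !inE negb_or; case/andP: ab => -> _; move: ta tb.
    by rewrite indep2C => /andP[-> _]; rewrite indep2C => /andP[-> _].
  have lE : l = \sum_(x <- [seq x <- index_enum X | x \notin B]) L x + 3.
    rewrite /l (sum_extend _ uB) big_cat /= !big_cons big_nil La Lb Lt //.
  have deg y : 2 * L y <= \sum_(z <- B) LL y z.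
    have [Ly|//] := boolP (L y); rewrite !big_cons big_nil /LL Ly La Lb Lt /=.
    case/andP: Ly => vy _.
    have := indep2_exchange vy ab; have := indep2_exchange vy ta.
    have := indep2_exchange vy tb.
    by case: (J y a); case: (J y b); case: (J y t).
  have degS s : 2 * (\sum_(y <- s) L y) <= \sum_(y <- s) \sum_(z <- B) LL y z.
    by rewrite big_distrr leq_sum.
  have E : e2 = \sum_(x <- [seq x <- index_enum X | x \notin B] ++ B)
      \sum_(y <- [seq x <- index_enum X | x \notin B] ++ B) LL x y.
    rewrite /e2 (sum_extend _ uB).
    by apply: eq_bigr => x _; rewrite (sum_extend _ uB).
  have LLC x y : (LL x y : nat) = LL y x.
    by rewrite /LL indep2C; case: (L x); case: (L y).
  have := sum_pairs_ge [seq x <- index_enum X | x \notin B] B LLC.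
  rewrite -E; have := degS [seq x <- index_enum X | x \notin B]; have := degS B.
  have -> : \sum_(y <- B) L y = 3 by rewrite !big_cons big_nil La Lb Lt.
  rewrite lE; clear.
  move: e2 (\sum_(y <- _) \sum_(z <- B) _) (\sum_(y <- B) \sum_(z <- B) _).
  move: (\sum_(x <- _) _) => n1 n2 n3 n4.
  by split; lia.
right.
have {}no t : L t -> J t a -> J t b = false.
  move=> Lt ta; apply/negP => tb; case/negP: no; apply/existsP; exists t.
  by rewrite Lt ta.
pose U x := L x && ~~ J x a; pose W x := L x && J x a.
exists (\sum_x U x), (\sum_x W x); split.
- by rewrite (bigD1 a) //= /U La indep2xx.
- by rewrite (bigD1 b) //= /W Lb indep2C ab.
- rewrite /l -big_split; apply: eq_bigr => x _ /=.
  by rewrite /U /W; case: (L x); case: (J x a).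
transitivity (\sum_x \sum_y (U x * W y + W x * U y)).
  apply: eq_bigr => x _; apply: eq_bigr => y _.
  rewrite /U /W /LL; case Lx: (L x) => //=; case Ly: (L y) => //=; last by rewrite !muln0.
  have vx : v x by case/andP: Lx.
  have vy : v y by case/andP: Ly.
  have va : v a by exact: indep2W ab.
  have vb : v b by exact: indep2W bc.
  case xa: (J x a); case ya: (J y a) => //=.
  - apply/eqP; rewrite eqb0; apply/negP => xy.
    by have := indep2_exchange vb xy; rewrite ![J b _]indep2C !no.
  - by have := indep2_exchange vy xa; rewrite ya orbF indep2C => ->.
  - by have := indep2_exchange vx ya; rewrite xa orbF => ->.
  - apply/eqP; rewrite eqb0; apply/negP => xy.
    by have := indep2_exchange va xy; rewrite ![J a _]indep2C xa ya.
under eq_bigr do rewrite big_split /= -!big_distrr /=.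
by rewrite big_split /= -!big_distrl /=; lia.
Qed.

Lemma split_counts : exists p l e : nat,
  [/\ 0 < p, count_indep M 1 = p + l, 2 * count_indep M 2 = 2 * (p * l) + e,
      2 * count_indep M 3 = p * e &
      (3 <= l /\ 4 * l <= e + 6) \/
      exists u w, [/\ 0 < u, 0 < w, l = u + w & e = 2 * (u * w)]].
Proof.
exists p, l, e2; split.
- exact: split_pos.
- exact: split_count1.
- exact: split_count2.
- exact: split_count3.
- exact: split_rank2.
Qed.

End Split.
End Structure.

(** * The reliability polynomial in rank three and its roots *)

Lemma Rel_horner_rank3 (A : comNzRingType) (X : finType) (M : matroid X) (z : A) :
  matroid_rank M = 3%N ->
  (Rel A M).[z] = (1 - z) ^+ (#|X| - 3) *
    \sum_(k < 4) (z ^+ k * (1 - z) ^+ (3 - k)) *+ count_indep M k.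
Proof.
move=> rk; have le3 s : s \in indep M -> (#|s| < 4)%N.
  by move=> sM; rewrite ltnS -rk; exact: leq_bigmax_cond.
rewrite /Rel horner_sum.
(* Independent sets have size below 4, so [inord] never takes its default value on them. *)
rewrite (partition_big (fun s : {set X} => inord #|s| : 'I_4) predT) //=.
rewrite big_distrr; apply: eq_bigr => k _ /=.
rewrite (eq_bigr (fun=> (1 - z) ^+ (#|X| - 3) * (z ^+ k * (1 - z) ^+ (3 - k)))).
  rewrite sumr_const mulrnAr; congr (_ *+ _); apply: eq_card => s.
  rewrite !inE unfold_in /=; apply: andb_id2l => sM.
  by rewrite -val_eqE /= inordK // le3.
move=> s /andP[sM /eqP sk].
have {}sk : #|s| = k by rewrite -sk inordK // le3.
rewrite !hornerE sk /= mulrAC -exprD [RHS]mulrC.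
congr (_ * _ ^+ _).
(* Rank three forces [3 <= #|X|], so the truncated subtractions in the exponents are exact. *)
have := cardsC s; have : (3 <= #|X|)%N.
  by rewrite -rk; apply/bigmax_leqP => t _; exact: max_card.
have := le3 s sM; rewrite sk.
move: #|X| #|~: s| (nat_of_ord k) => m n j.
lia.
Qed.

Lemma rank3_basis (X : finType) (M : matroid X) :
  matroid_rank M = 3%N -> exists a b c, indep3 M a b c.
Proof.
move=> rk.
have M0 : (0 < #|indep M|)%N by apply/card_gt0P; exists set0; exact: set0_indep.
have [s sM] := eq_bigmax_cond (fun s : {set X} => #|s|) M0.
rewrite -/(matroid_rank M) rk => s3.
have /card_gt0P[x xs] : (0 < #|s|)%N by rewrite -s3.
have /cards2P[y [t [yt sE]]] : #|s :\ x| == 2%N.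
  by move: s3; rewrite (cardsD1 x) xs add1n => -[<-].
exists x, y, t; have : x \notin s :\ x by rewrite !inE eqxx.
rewrite sE !inE negb_or => /andP[xy xt].
by rewrite /indep3 /= !inE negb_or xy xt yt -setUA -sE setD1K.
Qed.

Lemma rank3_poly_root_norm_le1 (R : rcfType) (X : finType) (M : matroid X) (z : R[i]) :
  matroid_rank M = 3%N ->
  \sum_(k < 4) (z ^+ k * (1 - z) ^+ (3 - k)) *+ count_indep M k = 0 ->
  `|z| <= 1.
Proof.
have cB (x y : R) : (x - y)%:C = x%:C - y%:C by exact: rmorphB.
have cD (x y : R) : (x + y)%:C = x%:C + y%:C by exact: rmorphD.
have cM (x y : R) : (x * y)%:C = x%:C * y%:C by exact: rmorphM.
have cV (x : R) : (x^-1)%:C = x%:C^-1 by exact: fmorphV.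
have cn n : (n%:R : R)%:C = n%:R by exact: rmorph_nat.
move=> rk; rewrite !big_ord_recr big_ord0 /= add0r count_indep0.
rewrite !(subSS, subn0, subnn, expr0, expr1, mulr1, mul1r, mulr1n).
rewrite -[_ *+ count_indep M 1]mulr_natr -[_ *+ count_indep M 2]mulr_natr.
rewrite -[_ *+ count_indep M 3]mulr_natr => H.
have [a0 [b0 [c0 abc]]] := rank3_basis rk.
have [[a [b [c [d h]]]]|[a [b [c h]]]] := four_circuit_or_split abc.
  have [le1 le2 le3 le4] := four_circuit_counts h.
  move: (count_indep M 1) (count_indep M 2) (count_indep M 3) H le1 le2 le3 le4.
  move=> F1 F2 F3 H le1 le2 le3 le4.
  pose f1 : R := F1%:R; pose f2 : R := F2%:R; pose f3 : R := F3%:R.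
  have {}le1 : 2 * f2 + 8 <= f3 + 4 * f1 by rewrite -!natrM -!natrD ler_nat.
  have {}le2 : f2 <= f3 + 2 by rewrite -!natrD ler_nat.
  have {}le3 : 3 * f1 <= f2 + 6 by rewrite -!natrM -!natrD ler_nat.
  have {}le4 : 4 <= f1 by rewrite ler_nat.
  (* These are the coefficients obtained by expanding [H] in powers of [z]. *)
  apply: (@cubic_root_norm_le1 _ (f1 - 3) (f2 - 2 * f1 + 3) (f3 - f2 + f1 - 1)).
  - by apply/andP; split; lra.
  - by apply/andP; split; lra.
  - lra.
  rewrite -[RHS]H !(cB, cD, cM) !cn.
  rewrite (cn 1).
  ring.
have [p [l [e [p0 E1 E2 E3 rk2]]]] := split_counts h.
(* The number of independent pairs in the flat; halving in the field avoids tracking the parity of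
   [e]. *)
pose f2 : R[i] := e%:R / 2.
have F1 : (count_indep M 1)%:R = p%:R + l%:R :> R[i] by rewrite E1 natrD.
have F2 : (count_indep M 2)%:R = p%:R * l%:R + f2.
  apply: (mulfI (x := 2)); first by rewrite pnatr_eq0.
  move: (congr1 (fun n => n%:R : R[i]) E2); rewrite natrD !natrM => ->.
  by rewrite /f2; field.
have F3 : (count_indep M 3)%:R = p%:R * f2.
  apply: (mulfI (x := 2)); first by rewrite pnatr_eq0.
  move: (congr1 (fun n => n%:R : R[i]) E3); rewrite !natrM => ->.
  by rewrite /f2; field.
(* Up to loops the matroid is the direct sum of the parallel class and the flat, hence the
   factorization. *)
have : (1 - z + p%:R * z) *
       ((1 - z) ^+ 2 + l%:R * z * (1 - z) + f2 * z ^+ 2) = 0.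
  rewrite -[RHS]H F1 F2 F3; ring.
move/eqP; rewrite mulf_eq0 => /orP[/eqP|]; first exact: linear_root_norm_le1.
case: rk2 => [[l3 le]|[u [w [u0 w0 El Ee]]]]; last first.
  have -> : (1 - z) ^+ 2 + l%:R * z * (1 - z) + f2 * z ^+ 2 =
            (1 - z + u%:R * z) * (1 - z + w%:R * z).
    by rewrite /f2 El Ee !(natrD, natrM); field.
  by rewrite mulf_eq0 => /orP[]/eqP; exact: linear_root_norm_le1.
move/eqP => H2.
pose rl : R := l%:R; pose re : R := e%:R / 2.
have {}le : 4 * rl <= re * 2 + 6.
  by rewrite /re divfK ?pnatr_eq0 // -natrM -natrD ler_nat.
have {}l3 : 3 <= rl by rewrite ler_nat.
(* The coefficients come from expanding the quadratic factor; the bounds follow from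
   [e / 2 >= 2 l - 3] and [l >= 3]. *)
apply: (@quadratic_root_norm_le1 _ (rl - 2) (re - rl + 1)); [lra|lra|lra|].
rewrite -[RHS]H2 /f2 !(cB, cD, cM, cV) !cn (cn 1).
ring.
Qed.

Theorem theorem5 (R : realType) (X : finType) (M : matroid X)
    (hrank : matroid_rank M = 3%N) (z : R[i])
    (hz : root (Rel R[i] M) z) : `|z| <= 1.
Proof.
move: hz; rewrite rootE Rel_horner_rank3 // mulf_eq0 => /orP[|/eqP].
  rewrite expf_eq0 subr_eq0 => /andP[_ /eqP <-].
  by rewrite normr1.
exact: rank3_poly_root_norm_le1.
Qed.
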